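(* (Quasi-shuffle PBW theorem.) Let $k$ be a field. Consider the forgetful functor from the category of quasi-shuffle algebras over $k$ to the category of nonunital commutative (associative) algebras over $k$ sending $(A,\prec,\bullet)$ to $(A,\bullet)$. Its left adjoint $U$ is, up to isomorphism, the functor $V\mapsto T^+(V)$ sending a nonunital commutative algebra $V$ to the quasi-shuffle algebra $T^+(V)$.
   Context: A quasi-shuffle algebra is a nonunital commutative associative algebra $(A,\bullet)$ with another bilinear product $\prec$ such that $(x\prec y)\prec z=x\prec(y\star z)$ and $(x\bullet y)\prec z=x\bullet(y\prec z)$, where $x\star y:=x\prec y+y\prec x+x\bullet y$. Morphisms are linear maps preserving $\prec$ and $\bullet$. For a nonunital commutative algebra $(V,\cdot)$, $T^+(V)=\bigoplus_{n\ge1}V^{\otimes n}$ is the quasi-shuffle algebra whose operations are defined inductively, for $a,b\in V$ and tensors (words) $v,w\in T(V)=k\oplus T^+(V)$, by $av\prec bw=a(v\star bw)$ and $av\bullet bw=(a\cdot b)(v\star w)$, where $av\star bw=a(v\star bw)+b(av\star w)+(a\cdot b)(v\star w)$ and $1\star v=v\star1=v$. *)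

(* Defs.v *)
From HB Require Import structures.
From mathcomp Require Import all_boot ssrAC all_algebra finmap.
From mathcomp Require Import boolp.
From mathcomp.multinomials Require Import monalg.

Set Implicit Arguments.
Unset Strict Implicit.
Unset Printing Implicit Defensive.

Import GRing.Theory.
Local Open Scope quotient_scope.
Local Open Scope ring_scope.

Reserved Notation "x • y" (at level 40, left associativity).
Reserved Notation "x ≺ y" (at level 40, left associativity).
Reserved Notation "x ⋆ y" (at level 40, left associativity).

(* Linearity of bullet on the right follows from bulletC. *)
HB.mixin Record isNuComAlg (k : fieldType) V of GRing.Lmodule k V := {
  bullet : V -> V -> V;
  bulletA : associative bullet;
  bulletC : commutative bullet;
  bullet_linearl : forall y, linear (bullet^~ y)
}.

#[short(type="nuComAlgType")]
HB.structure Definition NuComAlg (k : fieldType) :=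
  {V of isNuComAlg k V & GRing.Lmodule k V}.

Notation "x • y" := (bullet x y) : ring_scope.

HB.mixin Record isQuasiShuffle (k : fieldType) A of NuComAlg k A := {
  prec : A -> A -> A;
  prec_linearl : forall y, linear (prec^~ y);
  prec_linearr : forall x, linear (prec x);
  prec_prec : forall x y z : A,
    prec (prec x y) z = prec x (prec y z + prec z y + bullet y z);
  bullet_prec : forall x y z : A,
    prec (bullet x y) z = bullet x (prec y z)
}.

#[short(type="quasiShuffleType")]
HB.structure Definition QuasiShuffle (k : fieldType) :=
  {A of isQuasiShuffle k A & NuComAlg k A}.

Notation "x ≺ y" := (prec x y) : ring_scope.

Definition star (k : fieldType) (A : quasiShuffleType k) (x y : A) : A :=
  x ≺ y + y ≺ x + x • y.

Notation "x ⋆ y" := (star x y) : ring_scope.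

Lemma prec_star (k : fieldType) (A : quasiShuffleType k) (x y z : A) :
  (x ≺ y) ≺ z = x ≺ (y ⋆ z).
Proof. exact: prec_prec. Qed.

Record nuComAlgHom (k : fieldType) (A B : nuComAlgType k) := NuComAlgHom {
  nuComAlg_fun :> A -> B;
  nuComAlgHom_linear : linear nuComAlg_fun;
  nuComAlgHom_bullet : {morph nuComAlg_fun : x y / x • y}
}.

Record quasiShuffleHom (k : fieldType) (A B : quasiShuffleType k) :=
  QuasiShuffleHom {
  quasiShuffle_fun :> A -> B;
  quasiShuffleHom_linear : linear quasiShuffle_fun;
  quasiShuffleHom_prec : {morph quasiShuffle_fun : x y / x ≺ y};
  quasiShuffleHom_bullet : {morph quasiShuffle_fun : x y / x • y}
}.

Record category := Category {
  obj :> Type;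
  hom : obj -> obj -> Type;
  idm : forall X, hom X X;
  compose : forall X Y Z, hom Y Z -> hom X Y -> hom X Z;
  comp_idl : forall X Y (f : hom X Y), compose (idm Y) f = f;
  comp_idr : forall X Y (f : hom X Y), compose f (idm X) = f;
  comp_assoc : forall W X Y Z (h : hom Y Z) (g : hom X Y) (f : hom W X),
    compose h (compose g f) = compose (compose h g) f
}.
Arguments hom {c}.
Arguments idm {c}.
Arguments compose {c X Y Z}.

Record functor (C D : category) := Functor {
  fobj :> C -> D;
  fmor : forall X Y : C, hom X Y -> hom (fobj X) (fobj Y);
  fmor_id : forall X : C, fmor (idm X) = idm (fobj X);
  fmor_comp : forall (X Y Z : C) (g : hom Y Z) (f : hom X Y),
    fmor (compose g f) = compose (fmor g) (fmor f)
}.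
Arguments fmor {C D} _ {X Y}.

Definition is_iso (C : category) (X Y : C) (f : hom X Y) : Prop :=
  exists g : hom Y X, compose g f = idm X /\ compose f g = idm Y.

Definition natural (C D : category) (F G : functor C D)
    (eta : forall X : C, hom (F X) (G X)) : Prop :=
  forall (X Y : C) (f : hom X Y),
    compose (eta Y) (fmor F f) = compose (fmor G f) (eta X).

Definition naturally_isomorphic (C D : category) (F G : functor C D) : Prop :=
  exists eta : forall X : C, hom (F X) (G X),
    natural eta /\ forall X : C, is_iso (eta X).

Definition left_adjoint (C D : category)
    (F : functor C D) (G : functor D C) : Prop :=
  exists phi : forall (X : C) (Y : D), hom (F X) Y -> hom X (G Y),
    [/\ forall X Y, bijective (phi X Y),
        forall (X X' : C) (Y : D) (f : hom X' X) (h : hom (F X) Y),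
          phi X' Y (compose h (fmor F f)) = compose (phi X Y h) f
      & forall (X : C) (Y Y' : D) (g : hom Y Y') (h : hom (F X) Y),
          phi X Y' (compose g h) = compose (fmor G g) (phi X Y h)].

Section Categories.
Variable k : fieldType.

Lemma nuComAlgHom_eq (A B : nuComAlgType k) (f g : nuComAlgHom A B) :
  f =1 g -> f = g.
Proof.
case: f => f f1 f2; case: g => g g1 g2 /= /funext fg.
by case: _ / fg in g1 g2 *; congr NuComAlgHom; exact: Prop_irrelevance.
Qed.

Lemma quasiShuffleHom_eq (A B : quasiShuffleType k) (f g : quasiShuffleHom A B) :
  f =1 g -> f = g.
Proof.
case: f => f f1 f2 f3; case: g => g g1 g2 g3 /= /funext fg.
by case: _ / fg in g1 g2 g3 *; congr QuasiShuffleHom; exact: Prop_irrelevance.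
Qed.

Definition nuComAlg_id (A : nuComAlgType k) : nuComAlgHom A A.
Proof. by exists id. Defined.

Definition nuComAlg_compose (A B C : nuComAlgType k)
  (g : nuComAlgHom B C) (f : nuComAlgHom A B) : nuComAlgHom A C.
Proof.
exists (g \o f).
- by move=> a x y /=; rewrite !nuComAlgHom_linear.
- by move=> x y /=; rewrite !nuComAlgHom_bullet.
Defined.

Definition quasiShuffle_id (A : quasiShuffleType k) : quasiShuffleHom A A.
Proof. by exists id. Defined.

Definition quasiShuffle_compose (A B C : quasiShuffleType k)
  (g : quasiShuffleHom B C) (f : quasiShuffleHom A B) : quasiShuffleHom A C.
Proof.
exists (g \o f).
- by move=> a x y /=; rewrite !quasiShuffleHom_linear.
- by move=> x y /=; rewrite !quasiShuffleHom_prec.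
- by move=> x y /=; rewrite !quasiShuffleHom_bullet.
Defined.

Definition nuComAlgCat : category.
Proof.
exists (nuComAlgType k) (@nuComAlgHom k) nuComAlg_id nuComAlg_compose.
- by move=> *; exact: nuComAlgHom_eq.
- by move=> *; exact: nuComAlgHom_eq.
- by move=> *; exact: nuComAlgHom_eq.
Defined.

Definition quasiShuffleCat : category.
Proof.
exists (quasiShuffleType k) (@quasiShuffleHom k)
  quasiShuffle_id quasiShuffle_compose.
- by move=> *; exact: quasiShuffleHom_eq.
- by move=> *; exact: quasiShuffleHom_eq.
- by move=> *; exact: quasiShuffleHom_eq.
Defined.

Definition forget_hom (A B : quasiShuffleType k) (f : quasiShuffleHom A B) :
  nuComAlgHom A B :=
  NuComAlgHom (quasiShuffleHom_linear f) (quasiShuffleHom_bullet f).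

Definition forgetful : functor quasiShuffleCat nuComAlgCat.
Proof.
exists (fun A : quasiShuffleCat => (A : nuComAlgType k) : nuComAlgCat) forget_hom.
- by move=> *; exact: nuComAlgHom_eq.
- by move=> *; exact: nuComAlgHom_eq.
Defined.

End Categories.

Section LinearMaps.
Variables (k : fieldType) (U M N : lmodType k).
Implicit Types (f g : U -> M).

Lemma linD f : linear f -> {morph f : x y / x + y}.
Proof. by move=> lf x y; rewrite -[x]scale1r lf !scale1r. Qed.

Lemma lin0 f : linear f -> f 0 = 0.
Proof. by move=> lf; apply: (addIr (f 0)); rewrite -linD // !add0r. Qed.

Lemma lin_comp (h : M -> N) f : linear h -> linear f -> linear (fun x => h (f x)).
Proof. by move=> lh lf a x y; rewrite lf lh. Qed.

Lemma lin_add f g : linear f -> linear g -> linear (fun x => f x + g x).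
Proof. by move=> lf lg a x y; rewrite lf lg addrACA -scalerDr. Qed.

Lemma lin_scale b f : linear f -> linear (fun x => b *: f x).
Proof. by move=> lf a x y; rewrite lf scalerDr !scalerA mulrC. Qed.

End LinearMaps.

Section Span.
Variables (k : fieldType) (U : lmodType k) (S : U -> Prop).

Inductive spanned : U -> Prop :=
| spanned0 : spanned 0
| spannedZD a x y : S x -> spanned y -> spanned (a *: x + y).

Definition span_pred : {pred U} := fun x => `[< spanned x >].

Lemma span_predP x : reflect (spanned x) (x \in span_pred).
Proof. exact: asboolP. Qed.

Lemma spanned_gen x : S x -> spanned x.
Proof. by move=> Sx; rewrite -[x]scale1r -[_ *: _]addr0; do 2?constructor. Qed.

Lemma span_pred_submod : submod_closed span_pred.
Proof.
split; first by apply/asboolP; constructor.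
move=> a x y /asboolP sx /asboolP sy; apply/asboolP.
elim: sx => [|b z t Sz _ IH]; first by rewrite scaler0 add0r.
by rewrite scalerDr scalerA -addrA; constructor.
Qed.

HB.instance Definition _ := GRing.isSubmodClosed.Build k U span_pred
  span_pred_submod.

End Span.

Lemma lin_span_eq (k : fieldType) (U M : lmodType k) (S : U -> Prop)
    (f g : U -> M) : linear f -> linear g ->
  (forall x, S x -> f x = g x) -> forall x, spanned S x -> f x = g x.
Proof.
move=> lf lg fg x; elim=> [|a y z Sy _ IH]; first by rewrite !lin0.
by rewrite lf lg IH fg.
Qed.

Section Tensor.
Variables (k : fieldType) (V : lmodType k).

Definition multilinear (M : lmodType k) (phi : seq V -> M) : Prop :=
  forall (u w : seq V) (a : k) (x y : V),
    phi (u ++ (a *: x + y) :: w) = a *: phi (u ++ x :: w) + phi (u ++ y :: w).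

(* T(V) is the free module on all words over V modulo multilinearity in each
   letter.  The relations are homogeneous in the length, so this is the direct
   sum over n of the tensor powers of V, i.e. of the free modules on n-tuples
   modulo multilinearity. *)
Inductive multilinear_rel : {malg k[seq V]} -> Prop :=
  MultilinearRel (u w : seq V) (a : k) (x y : V) :
    multilinear_rel (<< u ++ (a *: x + y) :: w >>
                     - (a *: << u ++ x :: w >> + << u ++ y :: w >>)).

Definition tens := Quotient.quot (span_pred multilinear_rel).

HB.instance Definition _ := GRing.Zmodule.on tens.

Definition tens_pi (g : {malg k[seq V]}) : tens :=
  \pi_(Quotient.quot (span_pred multilinear_rel)) g.
Definition tens_repr (t : tens) : {malg k[seq V]} := repr t.

Lemma tens_reprK : cancel tens_repr tens_pi.
Proof. exact: reprK. Qed.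

Lemma tens_piP g h : tens_pi g = tens_pi h <-> spanned multilinear_rel (g - h).
Proof.
have := Quotient.idealrBE (span_pred multilinear_rel) g h.
rewrite /tens_pi => E; split=> [/eqP|/asboolP]; first by rewrite -E => /asboolP.
by move=> H; apply/eqP; rewrite -E.
Qed.

Lemma tens_piD : {morph tens_pi : g h / g + h}.
Proof. exact: Quotient.pi_add. Qed.

Definition tens_scale (a : k) (t : tens) : tens := tens_pi (a *: tens_repr t).

Lemma tens_piZ a g : tens_pi (a *: g) = tens_scale a (tens_pi g).
Proof.
apply/tens_piP; rewrite -scalerBr; apply/span_predP.
by apply: rpredZ; apply/span_predP/tens_piP; rewrite tens_reprK.
Qed.

Lemma tens_quotW (P : tens -> Prop) : (forall g, P (tens_pi g)) -> forall t, P t.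
Proof. by move=> H t; rewrite -[t]tens_reprK. Qed.

Fact tens_scaleA a b t :
  tens_scale a (tens_scale b t) = tens_scale (a * b) t.
Proof. by elim/tens_quotW: t => g; rewrite -!tens_piZ scalerA. Qed.

Fact tens_scale1 : left_id 1 tens_scale.
Proof. by elim/tens_quotW=> g; rewrite -tens_piZ scale1r. Qed.

Fact tens_scaleDr : right_distributive tens_scale +%R.
Proof.
move=> a; elim/tens_quotW=> g; elim/tens_quotW=> h.
by rewrite -tens_piD -!tens_piZ scalerDr tens_piD.
Qed.

Fact tens_scaleDl t : {morph tens_scale^~ t : a b / a + b}.
Proof.
by elim/tens_quotW: t => g a b; rewrite -!tens_piZ scalerDl tens_piD.
Qed.

HB.instance Definition _ := GRing.Zmodule_isLmodule.Build k tens
  tens_scaleA tens_scale1 tens_scaleDr tens_scaleDl.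

Lemma tens_pi_linear : linear tens_pi.
Proof. by move=> a g h; rewrite tens_piD tens_piZ. Qed.

End Tensor.

(* The pure tensor of the letters of w; tword [::] spans the summand k. *)
HB.lock Definition tword (k : fieldType) (V : lmodType k) (w : seq V) : tens V :=
  tens_pi << w >>.

(* The linear extension of phi when phi is multilinear. *)
HB.lock Definition tlift (k : fieldType) (V M : lmodType k) (phi : seq V -> M)
  (t : tens V) : M :=
  \sum_(w <- msupp (tens_repr t)) (tens_repr t)@_w *: phi w.

Section Lift.
Variables (k : fieldType) (V : lmodType k).
Local Notation multilinear_rel := (@multilinear_rel k V).
Local Notation tword := (@tword k V).

Lemma tword_multilinear : multilinear tword.
Proof.
move=> u w a x y; rewrite tword.unlock -tens_pi_linear.
by apply/tens_piP/spanned_gen.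
Qed.

Lemma tens_spanned t : spanned (fun t => exists w, t = tword w) t.
Proof.
elim/tens_quotW: t => g; rewrite [g]monalgE.
elim: (X in \sum_(w <- X) _) => [|w s IH].
  by rewrite big_nil (lin0 (@tens_pi_linear k V)); constructor.
rewrite big_cons; have -> : << g@_w *g w >> = g@_w *: << w >> :> {malg k[seq V]}.
  by apply/malgP=> v; rewrite mcoeffZ !mcoeffU mulrnAr mulr1.
by rewrite tens_pi_linear; constructor => //; exists w; rewrite tword.unlock.
Qed.

Section TLift.
Variables (M : lmodType k) (phi : seq V -> M).

Let flift (g : {malg k[seq V]}) : M := \sum_(w <- msupp g) g@_w *: phi w.

Let fliftEw (d : {fset seq V}) g : fsubset (msupp g) d ->
  flift g = \sum_(w <- d) g@_w *: phi w.
Proof.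
move=> sd; rewrite /flift (big_fset_incl _ sd) //= => w _.
by move=> /mcoeff_outdom ->; rewrite scale0r.
Qed.

Let flift_linear : linear flift.
Proof.
move=> a g h; pose d := (msupp (a *: g + h) `|` (msupp g `|` msupp h))%fset.
rewrite !(@fliftEw d) ?fsubsetUl //; last 2 first.
- by rewrite /d fsetUA fsubsetUr.
- by rewrite /d fsetUCA fsubsetUl.
rewrite scaler_sumr -big_split /=; apply: eq_bigr => w _.
by rewrite mcoeffD mcoeffZ scalerDl scalerA.
Qed.

Let flift_word w : flift << w >> = phi w.
Proof.
by rewrite /flift msuppU oner_eq0 big_seq_fset1 mcoeffUU scale1r.
Qed.

Hypothesis phi_ml : multilinear phi.

Let flift_rel g : spanned multilinear_rel g -> flift g = 0.
Proof.
elim=> [|a _ y [u w b x z] _ IH]; first exact: lin0.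
rewrite flift_linear IH addr0.
rewrite addrC -scaleN1r !flift_linear !flift_word phi_ml.
by rewrite scaleN1r addNr scaler0.
Qed.

Let tlift_pi g : tlift phi (tens_pi g) = flift g.
Proof.
apply/eqP; rewrite tlift.unlock -/(flift _) -subr_eq0 addrC -scaleN1r.
rewrite -flift_linear; apply/eqP/flift_rel; rewrite scaleN1r addrC.
by apply/tens_piP; rewrite tens_reprK.
Qed.

Lemma tlift_linear : linear (tlift phi).
Proof.
move=> a; elim/tens_quotW=> g; elim/tens_quotW=> h.
by rewrite -tens_pi_linear !tlift_pi flift_linear.
Qed.

Lemma tlift_word w : tlift phi (tword w) = phi w.
Proof. by rewrite tword.unlock tlift_pi flift_word. Qed.

End TLift.
End Lift.

Section TensorOperations.
Variables (k : fieldType) (V : lmodType k).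

Lemma tens_lin_eq (M : lmodType k) (f g : tens V -> M) : linear f -> linear g ->
  (forall w, f (tword w) = g (tword w)) -> f =1 g.
Proof.
move=> lf lg fg t; apply: (lin_span_eq lf lg _ (tens_spanned t)).
by move=> _ [w ->].
Qed.

(* The linear map sending the word w to aw. *)
Definition tcons (a : V) : tens V -> tens V := tlift (fun w => tword (a :: w)).

Lemma tcons_linear a : linear (tcons a).
Proof.
by apply: tlift_linear => u w b x y; rewrite -!cat_cons tword_multilinear.
Qed.

Lemma tcons_word a w : tcons a (tword w) = tword (a :: w).
Proof.
by rewrite /tcons tlift_word // => u v b x y; rewrite -!cat_cons tword_multilinear.
Qed.

Lemma tcons_linearl t : linear (tcons^~ t).
Proof.
move=> a x y; move: t; apply: tens_lin_eq.
- exact: tcons_linear.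
- apply: lin_add; [apply: lin_scale|]; exact: tcons_linear.
- by move=> w; rewrite !tcons_word (@tword_multilinear _ _ [::]).
Qed.

(* The bilinear extension of phi when phi is multilinear in both words. *)
Definition tlift2 (M : lmodType k) (phi : seq V -> seq V -> M)
  (s t : tens V) : M := tlift (fun v => tlift (phi v) t) s.

Section Lift2.
Variables (M : lmodType k) (phi : seq V -> seq V -> M).
Hypothesis phi_mll : forall w, multilinear (phi^~ w).
Hypothesis phi_mlr : forall v, multilinear (phi v).

Let mll t : multilinear (fun v => tlift (phi v) t).
Proof.
move=> u w a x y; move: t; apply: tens_lin_eq; try exact: tlift_linear.
  by apply: lin_add; [apply: lin_scale|]; exact: tlift_linear.
by move=> v; rewrite !tlift_word // phi_mll.
Qed.

Lemma tlift2_word v w : tlift2 phi (tword v) (tword w) = phi v w.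
Proof. by rewrite /tlift2 !tlift_word. Qed.

Lemma tlift2_linearl t : linear ((tlift2 phi)^~ t).
Proof. exact: tlift_linear. Qed.

Lemma tlift2_linearr s : linear (tlift2 phi s).
Proof.
move=> a t t'; move: s; apply: tens_lin_eq; try exact: tlift2_linearl.
  by apply: lin_add; [apply: lin_scale|]; exact: tlift2_linearl.
by move=> v; rewrite /tlift2 !tlift_word // tlift_linear.
Qed.

End Lift2.

(* T^+(V) is the submodule of T(V) spanned by the nonempty words, i.e. the sum
   of the tensor powers of degree at least 1. *)
Definition nonempty_word (t : tens V) : Prop := exists a w, t = tword (a :: w).

Record tplus := TPlus {
  tplus_val :> tens V;
  tplus_valP : tplus_val \in span_pred nonempty_word
}.

HB.instance Definition _ := [isSub for tplus_val].
HB.instance Definition _ := [Choice of tplus by <:].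
HB.instance Definition _ := [SubChoice_isSubLmodule of tplus by <:].

Lemma tplus_val_linear : linear tplus_val.
Proof. by move=> a x y. Qed.

Lemma tcons_plus a t : tcons a t \in span_pred nonempty_word.
Proof.
rewrite /tcons tlift.unlock; apply: rpred_sum => w _; apply: rpredZ.
by apply/span_predP/spanned_gen; exists a, w.
Qed.

Lemma tlift2_plus (phi : seq V -> seq V -> tens V) s t :
  (forall v w, phi v w \in span_pred nonempty_word) ->
  tlift2 phi s t \in span_pred nonempty_word.
Proof.
by rewrite /tlift2 tlift.unlock => H; do 2![apply: rpred_sum => ? _; apply: rpredZ].
Qed.

Lemma tplus_lin_eq (M : lmodType k) (f g : tens V -> M) : linear f -> linear g ->
  (forall a w, f (tcons a w) = g (tcons a w)) ->
  forall t, t \in span_pred nonempty_word -> f t = g t.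
Proof.
move=> lf lg fg t /span_predP; apply: lin_span_eq => // _ [a [w ->]].
by rewrite -tcons_word fg.
Qed.

End TensorOperations.

Section AbstractStar.
Variables (k : fieldType) (V : nuComAlgType k) (M : lmodType k).
Variables (word : seq V -> M) (cons : V -> M -> M) (st : M -> M -> M).
Hypothesis st_linearl : forall y, linear (st^~ y).
Hypothesis st_linearr : forall x, linear (st x).
Hypothesis cons_linear : forall a, linear (cons a).
Hypothesis st1l : forall x, st (word [::]) x = x.
Hypothesis st1r : forall x, st x (word [::]) = x.
Hypothesis st_cons : forall a x b y, st (cons a x) (cons b y) =
  cons a (st x (cons b y)) + cons b (st (cons a x) y) + cons (a • b) (st x y).
Hypothesis word_cons : forall a w, word (a :: w) = cons a (word w).

Let stDl z x y : st (x + y) z = st x z + st y z.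
Proof. exact: (linD (st_linearl z)). Qed.
Let stDr z x y : st z (x + y) = st z x + st z y.
Proof. exact: (linD (st_linearr z)). Qed.
Let consD a x y : cons a (x + y) = cons a x + cons a y.
Proof. exact: (linD (cons_linear a)). Qed.

Lemma abstract_starA u v w :
  st (st (word u) (word v)) (word w) = st (word u) (st (word v) (word w)).
Proof.
elim: u v w => [|a u IHu] v w; first by rewrite !st1l.
elim: v w => [|b v IHv] w; first by rewrite st1l st1r.
elim: w => [|c w IHw]; first by rewrite !st1r.
move: (IHu (b :: v) (c :: w)) (IHu (b :: v) w) (IHu v (c :: w)) (IHu v w).
move: (IHv (c :: w)) (IHv w) IHw => {IHu IHv}.
rewrite !word_cons; move: (word u) (word v) (word w) => {}u {}v {}w.
move=> Hv Hv' Hw Hu1 Hu2 Hu3 Hu4.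
rewrite (st_cons a u b v) (st_cons b v c w) !stDl !stDr !st_cons.
rewrite Hu1 Hu2 Hu3 Hu4 Hv Hv'.
move: Hw; rewrite (st_cons a u b v) !stDl => Hw.
rewrite (st_cons b v c w) !stDr !consD -Hw !consD bulletA.
by rewrite [LHS](AC (5*3*3) (1*6*9*(2*(4*7*10)*5)*(3*8*11))).
Qed.

End AbstractStar.

Section QuasiShuffleProducts.
Variables (k : fieldType) (V : nuComAlgType k).
Local Notation T := (tens V).

Fixpoint star_word (v : seq V) : seq V -> T :=
  if v isn't a :: v' then fun w => tword w else
  fix star_word_v w :=
    if w isn't b :: w' then tword v else
    tcons a (star_word v' w) + tcons b (star_word_v w')
      + tcons (a • b) (star_word v' w').

Definition prec_word (v w : seq V) : T :=
  if v is a :: v' then tcons a (star_word v' w) else 0.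

Definition bullet_word (v w : seq V) : T :=
  if (v, w) is (a :: v', b :: w') then tcons (a • b) (star_word v' w') else 0.

Definition tstar : T -> T -> T := tlift2 star_word.
(* On T(V) the two products below are extended by zero when an argument for
   which they are undefined is the empty word; only their restrictions to
   T^+(V) matter. *)
Definition tprec : T -> T -> T := tlift2 prec_word.
Definition tbullet : T -> T -> T := tlift2 bullet_word.

Lemma star_word0 v : star_word v [::] = tword v. Proof. by case: v. Qed.

Lemma star_word_cons a v b w : star_word (a :: v) (b :: w) =
  tcons a (star_word v (b :: w)) + tcons b (star_word (a :: v) w)
    + tcons (a • b) (star_word v w).
Proof. by []. Qed.

Lemma star_wordC v w : star_word v w = star_word w v.
Proof.
elim: v w => [|a v IHv] w; first by rewrite star_word0.
elim: w => [|b w IHw]; first by rewrite star_word0.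
by rewrite !star_word_cons (IHv (b :: w)) IHw (IHv w) (bulletC a b) (addrC (tcons a _)).
Qed.

Let sum3 (a : k) (x y z x' y' z' : T) :
  (a *: x + x') + (a *: y + y') + (a *: z + z') =
  a *: (x + y + z) + (x' + y' + z').
Proof. by rewrite !scalerDr (addrACA (a *: x)) (addrACA (a *: x + _)). Qed.

Lemma star_word_mll w : multilinear (star_word^~ w).
Proof.
move=> u; elim: u w => [|c u IHu] w v a x y.
  elim: w => [|b w IHw].
    by rewrite !star_word0; exact: (@tword_multilinear _ _ [::]).
  move: IHw; rewrite !cat0s !star_word_cons => ->.
  rewrite bullet_linearl tcons_linear.
  rewrite (tcons_linearl _ a x) (tcons_linearl _ a (x • b)).
  exact: sum3.
elim: w => [|b w IHw]; first by rewrite !star_word0 tword_multilinear.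
by move: IHw; rewrite !cat_cons !star_word_cons => ->; rewrite !IHu !tcons_linear sum3.
Qed.

Lemma star_word_mlr v : multilinear (star_word v).
Proof. by move=> u w a x y; rewrite !(star_wordC v) star_word_mll. Qed.

Lemma prec_word_mll w : multilinear (prec_word^~ w).
Proof.
case=> [|c u] v a x y /=; first exact: tcons_linearl.
by rewrite star_word_mll tcons_linear.
Qed.

Lemma prec_word_mlr v : multilinear (prec_word v).
Proof.
case: v => [|c v] u w a x y /=; first by rewrite scaler0 addr0.
by rewrite star_word_mlr tcons_linear.
Qed.

Lemma bullet_wordC v w : bullet_word v w = bullet_word w v.
Proof.
case: v w => [|a v] [|b w]; [by []..|].
by rewrite /bullet_word bulletC star_wordC.
Qed.

Lemma bullet_word_mll w : multilinear (bullet_word^~ w).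
Proof.
case: w => [|b w]; first by case=> [|c u] v a x y; rewrite /= scaler0 addr0.
case=> [|c u] v a x y; rewrite /bullet_word /=.
  by rewrite bullet_linearl tcons_linearl.
by rewrite star_word_mll tcons_linear.
Qed.

Lemma bullet_word_mlr v : multilinear (bullet_word v).
Proof. by move=> u w a x y; rewrite !(bullet_wordC v) bullet_word_mll. Qed.

Lemma tstar_linearl t : linear (tstar^~ t).
Proof. exact: tlift2_linearl star_word_mll star_word_mlr t. Qed.
Lemma tstar_linearr t : linear (tstar t).
Proof. exact: tlift2_linearr star_word_mll star_word_mlr t. Qed.
Lemma tprec_linearl t : linear (tprec^~ t).
Proof. exact: tlift2_linearl prec_word_mll prec_word_mlr t. Qed.
Lemma tprec_linearr t : linear (tprec t).
Proof. exact: tlift2_linearr prec_word_mll prec_word_mlr t. Qed.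
Lemma tbullet_linearl t : linear (tbullet^~ t).
Proof. exact: tlift2_linearl bullet_word_mll bullet_word_mlr t. Qed.
Lemma tbullet_linearr t : linear (tbullet t).
Proof. exact: tlift2_linearr bullet_word_mll bullet_word_mlr t. Qed.

Lemma tstar_word v w : tstar (tword v) (tword w) = star_word v w.
Proof. exact: tlift2_word star_word_mll star_word_mlr v w. Qed.
Lemma tprec_word v w : tprec (tword v) (tword w) = prec_word v w.
Proof. exact: tlift2_word prec_word_mll prec_word_mlr v w. Qed.
Lemma tbullet_word v w : tbullet (tword v) (tword w) = bullet_word v w.
Proof. exact: tlift2_word bullet_word_mll bullet_word_mlr v w. Qed.

Let lin_id : linear (fun t : T => t). Proof. by []. Qed.

Ltac tlin := match goal with
| |- linear (fun x => x) => exact: lin_id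
| |- linear (tcons ?a) => exact: (tcons_linear a)
| |- linear (tstar ?tt0) => exact: (tstar_linearr tt0)
| |- linear (tprec ?tt0) => exact: (tprec_linearr tt0)
| |- linear (tbullet ?tt0) => exact: (tbullet_linearr tt0)
| |- linear (fun x => @?ff0 x + @?g x) => refine (@lin_add _ _ _ ff0 g _ _); tlin
| |- linear (fun x => tcons ?a (@?ff0 x)) =>
    refine (@lin_comp _ _ _ _ (tcons a) ff0 (tcons_linear a) _); tlin
| |- linear (fun x => tstar ?tt0 (@?ff0 x)) =>
    refine (@lin_comp _ _ _ _ (tstar tt0) ff0 (tstar_linearr tt0) _); tlin
| |- linear (fun x => tstar (@?ff0 x) ?tt0) =>
    refine (@lin_comp _ _ _ _ (tstar^~ tt0) ff0 (tstar_linearl tt0) _); tlin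
| |- linear (fun x => tprec ?tt0 (@?ff0 x)) =>
    refine (@lin_comp _ _ _ _ (tprec tt0) ff0 (tprec_linearr tt0) _); tlin
| |- linear (fun x => tprec (@?ff0 x) ?tt0) =>
    refine (@lin_comp _ _ _ _ (tprec^~ tt0) ff0 (tprec_linearl tt0) _); tlin
| |- linear (fun x => tbullet ?tt0 (@?ff0 x)) =>
    refine (@lin_comp _ _ _ _ (tbullet tt0) ff0 (tbullet_linearr tt0) _); tlin
| |- linear (fun x => tbullet (@?ff0 x) ?tt0) =>
    refine (@lin_comp _ _ _ _ (tbullet^~ tt0) ff0 (tbullet_linearl tt0) _); tlin
end.
Ltac text H := move: H; refine (tens_lin_eq _ _ _); cbv beta; [try tlin|try tlin|].

(* tstar1l, tstar1r, tstar_cons, tprec_cons and tbullet_cons are the inductive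
   rules of the operations of T(V), for arbitrary tensors v and w. *)
Lemma tstar1l t : tstar (tword [::]) t = t.
Proof. by text t => // w; rewrite tstar_word. Qed.

Lemma tstarC s t : tstar s t = tstar t s.
Proof.
text s => v.
text t => w.
by rewrite !tstar_word star_wordC.
Qed.

Lemma tstar1r t : tstar t (tword [::]) = t.
Proof. by rewrite tstarC tstar1l. Qed.

Lemma tstar_cons a v b w : tstar (tcons a v) (tcons b w) =
  tcons a (tstar v (tcons b w)) + tcons b (tstar (tcons a v) w)
    + tcons (a • b) (tstar v w).
Proof.
text v => v.
text w => w.
by rewrite !tcons_word !tstar_word.
Qed.

Lemma tprec_cons a v w : tprec (tcons a v) w = tcons a (tstar v w).
Proof.
text v => v.
text w => w.
by rewrite !tcons_word !tprec_word tstar_word.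
Qed.

Lemma tbullet_cons a v b w :
  tbullet (tcons a v) (tcons b w) = tcons (a • b) (tstar v w).
Proof.
text v => v.
text w => w.
by rewrite !tcons_word !tbullet_word tstar_word.
Qed.

Lemma tbulletC s t : tbullet s t = tbullet t s.
Proof.
text s => v.
text t => w.
by rewrite !tbullet_word bullet_wordC.
Qed.

Lemma tstarA s t u : tstar (tstar s t) u = tstar s (tstar t u).
Proof.
text s => v.
text t => w.
text u => x.
exact (@abstract_starA k V (tens V) (@tword k V) (@tcons k V) tstar tstar_linearl tstar_linearr
  (@tcons_linear k V)
  tstar1l tstar1r tstar_cons (fun a w => esym (tcons_word a w)) v w x).
Qed.

Lemma tprec_plus s t : tprec s t \in span_pred (@nonempty_word k V).
Proof.
apply: tlift2_plus => -[|a v] w; [exact: rpred0|exact: tcons_plus].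
Qed.

Lemma tbullet_plus s t : tbullet s t \in span_pred (@nonempty_word k V).
Proof.
apply: tlift2_plus => -[|a v] [|b w]; try exact: rpred0.
exact: tcons_plus.
Qed.

Ltac plusext := refine (tplus_lin_eq _ _ _); cbv beta; [try tlin|try tlin|].
Local Notation plus := (span_pred (@nonempty_word k V)).

Lemma tstar_plus s t : s \in plus -> t \in plus ->
  tstar s t = tprec s t + tprec t s + tbullet s t.
Proof.
move=> Hs Ht; move: s Hs; plusext => a v; move: t Ht; plusext => b w.
by rewrite tstar_cons !tprec_cons tbullet_cons (tstarC w).
Qed.

Lemma tprec_prec s t u : s \in plus ->
  tprec (tprec s t) u = tprec s (tstar t u).
Proof. by move: s; plusext => a v; rewrite !tprec_cons tstarA. Qed.

Lemma tbullet_prec s t u : s \in plus -> t \in plus ->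
  tprec (tbullet s t) u = tbullet s (tprec t u).
Proof.
move=> Hs Ht; move: s Hs; plusext => a v; move: t Ht; plusext => b w.
by rewrite !(tprec_cons, tbullet_cons) tstarA.
Qed.

Lemma tbulletA s t u : s \in plus -> t \in plus -> u \in plus ->
  tbullet s (tbullet t u) = tbullet (tbullet s t) u.
Proof.
move=> Hs Ht Hu; move: s Hs; plusext => a v; move: t Ht; plusext => b w.
by move: u Hu; plusext => c x; rewrite !tbullet_cons tstarA bulletA.
Qed.

Definition plus_prec (s t : tplus V) : tplus V := TPlus (tprec_plus s t).
Definition plus_bullet (s t : tplus V) : tplus V := TPlus (tbullet_plus s t).

Fact plus_bulletA : associative plus_bullet.
Proof. by move=> s t u; apply: val_inj; apply: tbulletA; exact: tplus_valP. Qed.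
Fact plus_bulletC : commutative plus_bullet.
Proof. by move=> s t; apply: val_inj; exact: tbulletC. Qed.
Fact plus_bullet_linearl t : linear (plus_bullet^~ t).
Proof. by move=> a s s'; apply: val_inj; exact: tbullet_linearl. Qed.

HB.instance Definition _ := isNuComAlg.Build k (tplus V)
  plus_bulletA plus_bulletC plus_bullet_linearl.

Fact plus_prec_linearl t : linear (plus_prec^~ t).
Proof. by move=> a s s'; apply: val_inj; exact: tprec_linearl. Qed.
Fact plus_prec_linearr s : linear (plus_prec s).
Proof. by move=> a t t'; apply: val_inj; exact: tprec_linearr. Qed.
Fact plus_prec_prec s t u : plus_prec (plus_prec s t) u =
  plus_prec s (plus_prec t u + plus_prec u t + t • u).
Proof.
apply: val_inj; rewrite /= tprec_prec ?tplus_valP //.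
by rewrite tstar_plus ?tplus_valP.
Qed.
Fact plus_bullet_prec (s t u : tplus V) :
  plus_prec (s • t) u = s • plus_prec t u.
Proof. by apply: val_inj; apply: tbullet_prec; exact: tplus_valP. Qed.

HB.instance Definition _ := isQuasiShuffle.Build k (tplus V)
  plus_prec_linearl plus_prec_linearr plus_prec_prec plus_bullet_prec.

Lemma tplus_precE (s t : tplus V) : \val (s ≺ t) = tprec s t. Proof. by []. Qed.
Lemma tplus_bulletE (s t : tplus V) : \val (s • t) = tbullet s t.
Proof. by []. Qed.

End QuasiShuffleProducts.

Section TensorFunctor.
Variable k : fieldType.

(* T(f): the word a1 ... an is sent to f(a1) ... f(an). *)
Definition tens_map (V W : lmodType k) (f : V -> W) : tens V -> tens W :=
  tlift (fun w => tword (map f w)).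

Section LinearMap.
Variables (V W : lmodType k) (f : V -> W).
Hypothesis lf : linear f.

Let map_ml : multilinear (fun w => tword (map f w)).
Proof. by move=> u w a x y; rewrite !map_cat /= lf tword_multilinear. Qed.

Lemma tens_map_linear : linear (tens_map f).
Proof. exact: tlift_linear map_ml. Qed.

Lemma tens_map_word w : tens_map f (tword w) = tword (map f w).
Proof. exact: tlift_word map_ml w. Qed.

Lemma tens_map_cons a t : tens_map f (tcons a t) = tcons (f a) (tens_map f t).
Proof.
move: t; refine (tens_lin_eq _ _ _).
- exact: lin_comp tens_map_linear (tcons_linear a).
- exact: lin_comp (tcons_linear _) tens_map_linear.
- by move=> w; rewrite tcons_word !tens_map_word tcons_word.
Qed.

Lemma tens_map_plus (t : tplus V) :
  tens_map f t \in span_pred (@nonempty_word k W).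
Proof.
case: t => t /= /span_predP; elim=> [|a _ y [b [w ->]] _ IH].
  by rewrite (lin0 tens_map_linear) rpred0.
rewrite tens_map_linear rpredD ?rpredZ //.
by rewrite tens_map_word; apply/span_predP/spanned_gen; exists (f b), (map f w).
Qed.

Definition tplus_map (t : tplus V) : tplus W := TPlus (tens_map_plus t).

Lemma tplus_map_linear : linear tplus_map.
Proof. by move=> a s t; apply: val_inj; exact: tens_map_linear. Qed.

End LinearMap.

Section AlgebraMap.
Variables (V W : nuComAlgType k) (f : nuComAlgHom V W).
Let lf := nuComAlgHom_linear f.
Local Notation F := (tens_map f).
Let F_lin := tens_map_linear lf.
Let F_cons := tens_map_cons lf.

Let F_star_word v w : F (star_word v w) = tstar (F (tword v)) (F (tword w)).
Proof.
have F0 : F (tword [::]) = tword [::] by exact: tens_map_word.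
have Fc b x : F (tword (b :: x)) = tcons (f b) (F (tword x)).
  by rewrite -tcons_word F_cons.
elim: v w => [|a v IHv] w; first by rewrite F0 tstar1l.
elim: w => [|b w IHw]; first by rewrite star_word0 F0 tstar1r.
rewrite star_word_cons !(linD F_lin) !F_cons IHv IHw IHv.
by rewrite !Fc tstar_cons nuComAlgHom_bullet.
Qed.

Lemma tens_map_star s t : F (tstar s t) = tstar (F s) (F t).
Proof.
move: s; refine (tens_lin_eq _ _ _) => [||v].
- exact: lin_comp F_lin (tstar_linearl t).
- exact: lin_comp (tstar_linearl _) F_lin.
move: t; refine (tens_lin_eq _ _ _) => [||w].
- exact: lin_comp F_lin (tstar_linearr _).
- exact: lin_comp (tstar_linearr _) F_lin.
by rewrite tstar_word F_star_word.
Qed.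

Lemma tens_map_prec s t : s \in span_pred (@nonempty_word k V) ->
  F (tprec s t) = tprec (F s) (F t).
Proof.
move: s; refine (tplus_lin_eq _ _ _) => [||a v].
- exact: lin_comp F_lin (tprec_linearl t).
- exact: lin_comp (tprec_linearl _) F_lin.
by rewrite tprec_cons !F_cons tprec_cons tens_map_star.
Qed.

Lemma tens_map_bullet s t : s \in span_pred (@nonempty_word k V) ->
  t \in span_pred (@nonempty_word k V) ->
  F (tbullet s t) = tbullet (F s) (F t).
Proof.
move=> Hs Ht; move: s Hs; refine (tplus_lin_eq _ _ _) => [||a v].
- exact: lin_comp F_lin (tbullet_linearl t).
- exact: lin_comp (tbullet_linearl _) F_lin.
move: t Ht; refine (tplus_lin_eq _ _ _) => [||b w].
- exact: lin_comp F_lin (tbullet_linearr _).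
- exact: lin_comp (tbullet_linearr _) F_lin.
by rewrite tbullet_cons !F_cons tbullet_cons tens_map_star nuComAlgHom_bullet.
Qed.

Definition tplus_hom : quasiShuffleHom (tplus V) (tplus W).
Proof.
exists (tplus_map lf).
- exact: tplus_map_linear.
- by move=> s t; apply: val_inj; apply: tens_map_prec; exact: tplus_valP.
- by move=> s t; apply: val_inj; apply: tens_map_bullet; exact: tplus_valP.
Defined.

End AlgebraMap.

Definition tplus_functor : functor (nuComAlgCat k) (quasiShuffleCat k).
Proof.
exists (fun V : nuComAlgCat k => (tplus V : quasiShuffleType k) : quasiShuffleCat k)
  tplus_hom.
- move=> V; apply: quasiShuffleHom_eq => t; apply: val_inj => /=.
  move: (val t); refine (tens_lin_eq _ _ _) => // [|w].
    exact: (tens_map_linear (nuComAlgHom_linear (nuComAlg_id V))).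
  by rewrite (tens_map_word (nuComAlgHom_linear (nuComAlg_id V))) map_id.
- move=> V W X g f; apply: quasiShuffleHom_eq => t; apply: val_inj => /=.
  have lg := nuComAlgHom_linear g; have lf := nuComAlgHom_linear f.
  have lgf := nuComAlgHom_linear (nuComAlg_compose g f).
  move: (val t); refine (tens_lin_eq _ _ _) => [||w].
  + exact: tens_map_linear lgf.
  + exact: lin_comp (tens_map_linear lg) (tens_map_linear lf).
  + by rewrite (tens_map_word lgf) (tens_map_word lf) (tens_map_word lg) -map_comp.
Defined.

End TensorFunctor.

(* Main.v *)
Require Import Defs.
From mathcomp Require Import all_boot all_algebra.
From mathcomp Require Import boolp.

(* A morphism f : V -> A of commutative algebras makes A a right module over
   the unital algebra (T(V), ⋆): the word a1 ... an sends x to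
   x ≺ (f a1 ≺ (f a2 ≺ ... ≺ f an)), and this action commutes with x • _.
   The extension of f to T^+(V) sends av to the image of f a under v, and the
   module axioms say exactly that it preserves ≺ and •.  It is unique because
   av = a ≺ v in T^+(V) when v is nonempty. *)

Set Implicit Arguments.
Unset Strict Implicit.
Unset Printing Implicit Defensive.

Import GRing.Theory.
Local Open Scope ring_scope.

(** * Uniqueness of left adjoints *)

Section LeftAdjointUniqueness.
Variables (C D : category) (G : functor D C).

(** A Yoneda argument: the comparison map [eta X] is the one that [phi] sends to the unit of [F'],
    and its inverse arises by exchanging the two adjunctions. *)
Lemma left_adjoint_unique (F F' : functor C D) :
  left_adjoint F G -> left_adjoint F' G -> naturally_isomorphic F F'.
Proof.
case=> phi [phi_bij phi_natl phi_natr] [phi' [phi'_bij phi'_natl phi'_natr]].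
have phiI X Y : injective (phi X Y) := bij_inj (phi_bij X Y).
have phi'I X Y : injective (phi' X Y) := bij_inj (phi'_bij X Y).
have ex_eta X : exists h, phi X (F' X) h = phi' X (F' X) (idm _).
  by have [g _ gK] := phi_bij X (F' X); exists (g (phi' X _ (idm _))); rewrite gK.
pose eta X := projT1 (cid (ex_eta X)).
have etaE X : phi X (F' X) (eta X) = phi' X (F' X) (idm _) := projT2 (cid (ex_eta X)).
exists eta; split=> [X Y f|X].
  (* After transposing, both sides become [phi'] of [fmor F' f]. *)
  apply: phiI; rewrite phi_natl phi_natr !etaE -phi'_natl -phi'_natr.
  by rewrite comp_idl comp_idr.
have [g _ gK] := phi'_bij X (F X).
have thetaE := gK (phi X (F X) (idm _)).
exists (g (phi X (F X) (idm _))); split.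
  by apply: phiI; rewrite phi_natr etaE -phi'_natr comp_idr thetaE.
by apply: phi'I; rewrite phi'_natr thetaE -phi_natr comp_idr etaE.
Qed.

End LeftAdjointUniqueness.

Lemma bullet_linearr (k : fieldType) (A : nuComAlgType k) (x : A) :
  linear (bullet x).
Proof. by move=> c y z; rewrite !(bulletC x) bullet_linearl. Qed.

(** * The unit of the adjunction: letters as words of length one *)

Section Unit.
Variables (k : fieldType) (V : nuComAlgType k).

Definition tplus_letter (a : V) : tplus V := TPlus (tcons_plus a (tword [::])).

Lemma tplus_letter_linear : linear tplus_letter.
Proof. by move=> c x y; apply: val_inj; exact: tcons_linearl. Qed.

Lemma tplus_letter_bullet : {morph tplus_letter : a b / a • b}.
Proof. by move=> a b; apply: val_inj; rewrite /= tbullet_cons tstar1l. Qed.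

Definition tplus_unit : nuComAlgHom V (tplus V) :=
  NuComAlgHom tplus_letter_linear tplus_letter_bullet.

End Unit.

Section Extension.
Variables (k : fieldType) (V : nuComAlgType k) (A : quasiShuffleType k).

(** * The action of T(V) on A *)

Section WordAction.
Variable f : nuComAlgHom V A.

Fixpoint word_act (x : A) (w : seq V) : A :=
  if w is a :: w' then x ≺ word_act (f a) w' else x.

Lemma word_act_linearl w : linear (word_act^~ w).
Proof. by case: w => [|a w] c x y //=; rewrite prec_linearl. Qed.

Lemma word_act_ml x : multilinear (word_act x).
Proof.
move=> u w c a b; elim: u x => [|d u IHu] x /=.
  by rewrite nuComAlgHom_linear word_act_linearl prec_linearr.
by rewrite IHu prec_linearr.
Qed.

(** Only the outermost ≺ involves the element acted upon, so a single use of [bullet_prec]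
    suffices. *)
Lemma word_act_bullet x y w : word_act (x • y) w = x • word_act y w.
Proof. by case: w => [|a w] //=; rewrite bullet_prec. Qed.

Definition tens_act (x : A) : tens V -> A := tlift (word_act x).

Lemma tens_act_linear x : linear (tens_act x).
Proof. exact: tlift_linear (word_act_ml x). Qed.

Lemma tens_act_word x w : tens_act x (tword w) = word_act x w.
Proof. exact: tlift_word (word_act_ml x) w. Qed.

Lemma tens_act_linearl t : linear (tens_act^~ t).
Proof.
move=> c x y; move: t; apply: tens_lin_eq.
- exact: tens_act_linear.
- by apply: lin_add; [apply: lin_scale|]; exact: tens_act_linear.
- by move=> w; rewrite !tens_act_word word_act_linearl.
Qed.

Lemma tens_act_bullet x y t : tens_act (x • y) t = x • tens_act y t.
Proof.
move: t; apply: tens_lin_eq.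
- exact: tens_act_linear.
- exact: lin_comp (bullet_linearr x) (tens_act_linear y).
- by move=> w; rewrite !tens_act_word word_act_bullet.
Qed.

Lemma tens_act_cons x a t : tens_act x (tcons a t) = x ≺ tens_act (f a) t.
Proof.
move: t; apply: tens_lin_eq.
- exact: lin_comp (tens_act_linear x) (tcons_linear a).
- exact: lin_comp (prec_linearr x) (tens_act_linear (f a)).
- by move=> w; rewrite tcons_word !tens_act_word.
Qed.

(** Right multiplications for ≺ commute with each other, because ⋆ is commutative in (x ≺ y) ≺ z = x
    ≺ (y ⋆ z). *)
Lemma word_act_precC x y w : word_act (x ≺ y) w = word_act x w ≺ y.
Proof.
case: w => [|a w] //=; rewrite !prec_prec bulletC.
by congr (_ ≺ (_ + _)); exact: addrC.
Qed.

(** Induction along the recursion of ⋆: its three summands match the three terms of p ⋆ q in (x ≺ p)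
    ≺ q = x ≺ (p ⋆ q), where p is [word_act (f a) v] and q is [word_act (f b) w]. *)
Lemma word_act_star x v w :
  word_act (word_act x v) w = tens_act x (star_word v w).
Proof.
elim: v x w => [|a v IHv] x w; first by rewrite /= tens_act_word.
elim: w x => [|b w IHw] x; first by rewrite /= tens_act_word.
(* By commutativity of •, each word can be made to act on the factor of its choice. *)
have E : word_act (word_act (f (a • b)) v) w = word_act (f a) v • word_act (f b) w.
  by rewrite nuComAlgHom_bullet bulletC word_act_bullet bulletC word_act_bullet.
rewrite star_word_cons !(linD (tens_act_linear x)) !tens_act_cons.
by rewrite -!IHv -IHw E -!(linD (prec_linearr x)) /= prec_prec word_act_precC.
Qed.

Lemma tens_act_star x s t : tens_act (tens_act x s) t = tens_act x (tstar s t).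
Proof.
move: s; refine (tens_lin_eq _ _ _) => [||v].
- exact: lin_comp (tens_act_linearl t) (tens_act_linear x).
- exact: lin_comp (tens_act_linear x) (tstar_linearl t).
move: t; refine (tens_lin_eq _ _ _) => [||w].
- exact: tens_act_linear.
- exact: lin_comp (tens_act_linear x) (tstar_linearr _).
by rewrite tstar_word !tens_act_word word_act_star.
Qed.

(** * The extension of f to T^+(V) *)

Definition word_extend (w : seq V) : A :=
  if w is a :: w' then word_act (f a) w' else 0.

Lemma word_extend_ml : multilinear word_extend.
Proof.
case=> [|d u] w c a b /=; last exact: word_act_ml.
by rewrite nuComAlgHom_linear word_act_linearl.
Qed.

Definition tens_extend : tens V -> A := tlift word_extend.

Lemma tens_extend_linear : linear tens_extend.
Proof. exact: tlift_linear word_extend_ml. Qed.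

Lemma tens_extend_cons a t : tens_extend (tcons a t) = tens_act (f a) t.
Proof.
move: t; apply: tens_lin_eq.
- exact: lin_comp tens_extend_linear (tcons_linear a).
- exact: tens_act_linear.
- by move=> w; rewrite tcons_word tens_act_word; exact: tlift_word word_extend_ml (a :: w).
Qed.

(** For s = av and t = bw, acting on f a by v ⋆ bw means acting by v and then by bw, and the latter
    is right multiplication by the image of bw. *)
Lemma tens_extend_prec s t : s \in span_pred (@nonempty_word k V) ->
  t \in span_pred (@nonempty_word k V) ->
  tens_extend (tprec s t) = tens_extend s ≺ tens_extend t.
Proof.
move=> Hs Ht; move: s Hs; refine (tplus_lin_eq _ _ _) => [||a v].
- exact: lin_comp tens_extend_linear (tprec_linearl t).
- exact: lin_comp (prec_linearl _) tens_extend_linear.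
move: t Ht; refine (tplus_lin_eq _ _ _) => [||b w].
- exact: lin_comp tens_extend_linear (tprec_linearr _).
- exact: lin_comp (prec_linearr _) tens_extend_linear.
by rewrite tprec_cons !tens_extend_cons -tens_act_star tens_act_cons.
Qed.

Lemma tens_extend_bullet s t : s \in span_pred (@nonempty_word k V) ->
  t \in span_pred (@nonempty_word k V) ->
  tens_extend (tbullet s t) = tens_extend s • tens_extend t.
Proof.
move=> Hs Ht; move: s Hs; refine (tplus_lin_eq _ _ _) => [||a v].
- exact: lin_comp tens_extend_linear (tbullet_linearl t).
- exact: lin_comp (bullet_linearl _) tens_extend_linear.
move: t Ht; refine (tplus_lin_eq _ _ _) => [||b w].
- exact: lin_comp tens_extend_linear (tbullet_linearr _).
- exact: lin_comp (bullet_linearr _) tens_extend_linear.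
(* On f a • f b the tensor v is moved to the first factor and w to the second. *)
rewrite tbullet_cons !tens_extend_cons -tens_act_star nuComAlgHom_bullet.
by rewrite bulletC tens_act_bullet bulletC tens_act_bullet.
Qed.

Definition tplus_extend : quasiShuffleHom (tplus V) A.
Proof.
exists (fun t => tens_extend (\val t)).
- by move=> c s t; exact: tens_extend_linear.
- by move=> s t; apply: tens_extend_prec; exact: tplus_valP.
- by move=> s t; apply: tens_extend_bullet; exact: tplus_valP.
Defined.

Lemma tplus_extend_letter a : tplus_extend (tplus_letter a) = f a.
Proof. by rewrite /= tens_extend_cons tens_act_word. Qed.

End WordAction.

(** The letters generate T^+(V) under ≺ and linear combinations. *)
Lemma tplus_hom_eq (g h : quasiShuffleHom (tplus V) A) :
  (forall a, g (tplus_letter a) = h (tplus_letter a)) -> g = h.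
Proof.
move=> gh; apply: quasiShuffleHom_eq.
have gh_word a w (aw : tword (a :: w) \in span_pred (@nonempty_word k V)) :
    g (TPlus aw) = h (TPlus aw).
  elim: w a aw => [|b w IHw] a aw.
    have -> : TPlus aw = tplus_letter a by apply: val_inj; rewrite /= tcons_word.
    exact: gh.
  have bw : tword (b :: w) \in span_pred (@nonempty_word k V).
    by rewrite -tcons_word tcons_plus.
  (* The letter a is a followed by the empty word, the unit of ⋆. *)
  have -> : TPlus aw = tplus_letter a ≺ TPlus bw.
    by apply: val_inj; rewrite /= tprec_cons tstar1l tcons_word.
  by rewrite !quasiShuffleHom_prec gh IHw.
have gl := quasiShuffleHom_linear g; have hl := quasiShuffleHom_linear h.
(* The membership proof [tP] stays general, as each step of the induction changes the tensor it
   concerns. *)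
case=> t tP; move/span_predP: (tP) => ts; elim: ts tP => [|c _ y [a [w ->]] ys IH] tP.
  by have -> : TPlus tP = 0 :> tplus V by [exact: val_inj]; rewrite !lin0.
have aw : tword (a :: w) \in span_pred (@nonempty_word k V).
  by rewrite -tcons_word tcons_plus.
have yP : y \in span_pred (@nonempty_word k V) by apply/span_predP.
have -> : TPlus tP = c *: TPlus aw + TPlus yP by exact: val_inj.
by rewrite gl hl gh_word IH.
Qed.

End Extension.

(** The bijection is restriction to letters, with [tplus_extend] as inverse. *)
Lemma tplus_left_adjoint (k : fieldType) :
  left_adjoint (tplus_functor k) (forgetful k).
Proof.
pose phi (V : nuComAlgCat k) (A : quasiShuffleCat k)
    (h : Defs.hom (tplus_functor k V) A) : Defs.hom V (forgetful k A) :=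
  nuComAlg_compose (forget_hom h) (tplus_unit V).
exists phi; split=> [V A|V V' A f h|V A A' g h].
- exists (@tplus_extend k V A) => [h|f].
    by apply: tplus_hom_eq => a; rewrite tplus_extend_letter.
  by apply: nuComAlgHom_eq => a; exact: tplus_extend_letter.
(* Naturality in V: T^+(f) sends the letter a to the letter f a. *)
- apply: nuComAlgHom_eq => a /=; congr (quasiShuffle_fun h _); apply: val_inj => /=.
  by rewrite !tcons_word (tens_map_word (nuComAlgHom_linear f)).
- exact: nuComAlgHom_eq.
Qed.

Theorem lemma21 (k : fieldType) :
  left_adjoint (tplus_functor k) (forgetful k) /\
  (forall U : functor (nuComAlgCat k) (quasiShuffleCat k),
     left_adjoint U (forgetful k) -> naturally_isomorphic U (tplus_functor k)).
Proof.
split=> [|U U_adj]; first exact: tplus_left_adjoint.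
exact: left_adjoint_unique U_adj (tplus_left_adjoint k).
Qed.
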